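(* Let $n_0,d\in\mathbb{N}$, and let $f\colon[n_0,\infty)\to\mathbb{R}$ be a differentiable function in $\mathcal{H}$ satisfying that (a1) $x^d\log x\prec f(x)\prec x^{d+1}$ as $x\to\infty$; (a2) $\inf_{x\ge n_0}f'(x)\ge1$. Then, for every integer $k\ge d+2$, there exist constants $C_1,C_2>0$ such that for all sufficiently large $N\in\mathbb{N}$, $$C_1\,N f^{(d+1)}(N)^{-1/(d+1)}\le\#\{P\subset[n_0,N]\cap\mathbb{Z} : P\in\mathcal{P}_{k,1},\ (\lfloor f(n)\rfloor)_{n\in P}\in\mathcal{P}_{k,d}\}\le C_2\,N f^{(d+1)}(N)^{-1/(d+1)}.$$ Moreover $C_1,C_2$ can be chosen to depend only on $k$, $d$ and $c(\cdot)$, where $c\colon(0,1)\to[1,\infty)$ is a function such that for every $\delta\in(0,1)$ there exists $x_0(\delta)\ge n_0/\delta$ with $f^{(d+1)}(\delta x)\le c(\delta)f^{(d+1)}(x)$ for all $x\ge x_0(\delta)$.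
   Context: $\mathbb{N}=\{1,2,\ldots\}$; $\lfloor x\rfloor$ is the greatest integer $\le x$. For (eventually) positive functions, $g_1(x)\prec g_2(x)$ means $g_2(x)/g_1(x)\to+\infty$ as $x\to\infty$. Hardy fields: let $\mathcal{B}$ be the ring (under pointwise addition and multiplication) of real-valued functions defined on intervals $[x_0,\infty)$ ($x_0$ depending on the function), where two functions are identified if they agree for all sufficiently large $x$. A Hardy field is a subfield of the ring $\mathcal{B}$ closed under differentiation. $\mathcal{H}$ denotes the union of all Hardy fields. In particular all derivatives of $f\in\mathcal{H}$ exist for sufficiently large $x$. For integers $d\ge1$ and $k\ge d+2$, $\mathcal{P}_{k,d}$ is the set of all strictly increasing sequences $(a(n))_{n=0}^{k-1}$ of elements of $\mathbb{N}$ such that $(\Delta_1^d a(n))_{n=0}^{k-d-1}$ is a constant sequence, where $\Delta_1 a(n)=a(n+1)-a(n)$ and $\Delta_1^m=\Delta_1\circ\Delta_1^{m-1}$ for $m\ge2$. Equivalently, $a(n)=p(n)$ for $0\le n<k$ for some polynomial $p\in\mathbb{Q}[x]$ of degree at most $d$. In particular $\mathcal{P}_{k,1}$ is the set of arithmetic progressions of length $k$ in $\mathbb{N}$. A subset of $\mathbb{N}$ is identified with the strictly increasing sequence of its elements; $(\lfloor f(n)\rfloor)_{n\in P}$ is indexed by the elements of $P$ in increasing order. *)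

(* Defs.v *)
From HB Require Import structures.
From mathcomp Require Import all_boot all_order all_algebra.
From mathcomp Require Import all_classical all_reals all_analysis.

Set Implicit Arguments.
Unset Strict Implicit.
Unset Printing Implicit Defensive.

Import Order.TTheory GRing.Theory Num.Theory.
Import numFieldNormedType.Exports.

Local Open Scope classical_set_scope.
Local Open Scope ring_scope.

Section HardyFields.
Variable R : realType.
Implicit Types (f g h : R -> R) (K : set (R -> R)).

Definition germ_eq g h : Prop := \forall x \near +oo, g x = h x.

(* A subset of the ring of germs at +oo is encoded as a set of functions
   R -> R that is stable under eventual equality; every function defined on
   some [x0, +oo[ has the same germ as a total function. *)
Record hardy_field K : Prop := HardyField {
  hardy_field_germ : forall g h, germ_eq g h -> K g -> K h ;
  hardy_field1 : K (cst 1) ;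
  hardy_fieldB : forall g h, K g -> K h -> K (fun x => g x - h x) ;
  hardy_fieldM : forall g h, K g -> K h -> K (fun x => g x * h x) ;
  hardy_fieldV : forall g, K g -> ~ germ_eq g (cst 0) ->
    exists2 h, K h & germ_eq (fun x => g x * h x) (cst 1) ;
  hardy_fieldD : forall g, K g ->
    exists2 h, K h & \forall x \near +oo, is_derive x (1 : R) g (h x)
}.

Definition in_hardy f : Prop := exists2 K, hardy_field K & K f.

Definition prec g1 g2 : Prop := g2 x / g1 x @[x --> +oo] --> +oo.

(* Derivative relative to a domain D: one-sided at a boundary point, and
   independent of the values of f outside D. *)
Definition diff_quot_within (D : set R) f (x : R) : set_system R :=
  (f y - f x) / (y - x) @[y --> within D x^'].

Definition differentiable_on (D : set R) f : Prop :=
  forall x, D x -> cvg (diff_quot_within D f x).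

Definition derive_within (D : set R) f (x : R) : R :=
  lim (diff_quot_within D f x).

(* f stands for a function on [n0, +oo[; its values elsewhere are
   irrelevant. *)
Record admissible (n0 d : nat) f : Prop := Admissible {
  admissible_diff : differentiable_on `[n0%:R, +oo[ f ;
  admissible_hardy : in_hardy f ;
  admissible_lower : prec (fun x => x ^+ d * ln x) f ;
  admissible_upper : prec f (fun x => x ^+ d.+1) ;
  admissible_inf :
    (1%:E <= ereal_inf [set (derive_within `[n0%:R, +oo[ f x)%:E
                       | x in `[n0%:R, +oo[%classic])%E
}.

Definition dilation_bound (n0 d : nat) f (c : R -> R) : Prop :=
  forall delta : R, 0 < delta < 1 ->
    exists2 x0 : R, n0%:R / delta <= x0 &
      forall x, x0 <= x -> f^`(d.+1)%classic (delta * x) <= c delta * f^`(d.+1)%classic x.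

End HardyFields.

Definition Delta1 (a : nat -> int) (n : nat) : int := a n.+1 - a n.

Definition is_calP (k d : nat) (a : seq int) : bool :=
  [&& size a == k,
      all (fun m => 0 < m) a,
      sorted <%R a
    & [forall n : 'I_(k - d),
         iter d Delta1 (nth 0 a) n == iter d Delta1 (nth 0 a) 0%N]].

(* [enum P] lists P in increasing order. *)
Definition elements (N : nat) (P : {set 'I_N.+1}) : seq nat :=
  [seq nat_of_ord i | i <- enum P].

Definition counted_aps (R : realType) (f : R -> R) (n0 k d N : nat) :
    {set {set 'I_N.+1}} :=
  [set P : {set 'I_N.+1} |
    [&& [forall i in P, (n0 <= i)%N],
        is_calP k 1 [seq n%:Z | n <- elements P]
      & is_calP k d [seq Num.floor (f n%:R) | n <- elements P]]]%SET.

Definition main_term (R : realType) (f : R -> R) (d N : nat) : R :=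
  N%:R * (f^`(d.+1)%classic N%:R) `^ (- 1 / d.+1%:R).

(* Main.v *)
Require Import Defs.
From HB Require Import structures.
From mathcomp Require Import all_boot all_order all_algebra.
From mathcomp Require Import all_classical all_reals all_analysis.
From mathcomp Require Import ring lra zify.

Set Implicit Arguments.
Unset Strict Implicit.
Unset Printing Implicit Defensive.

Import Order.TTheory GRing.Theory Num.Theory.
Import numFieldNormedType.Exports.

Local Open Scope classical_set_scope.
Local Open Scope ring_scope.

(** Write g for the derivative of order d+1 of f and X = g(N)^(-1/(d+1)), so
    that the main term is N X. A progression is a pair (b, r), with terms b + j r
    for j < k; it is counted when the differences of order d+1 of its floors
    floor (f (b + j r)) vanish. Differences of order d+1 of f itself along the
    progression are r^(d+1) g(xi) by the mean value theorem
    ([iter_shift_diff_bound]).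

    Upper bound. The fractional parts contribute at most 2^(d+1) to a
    difference of order d+1, so a counted progression satisfies
    r^(d+1) g(N) <= 2^(d+1), that is r <= 2 X ([good_small_step]). There are
    O(N X) such pairs; the finitely many b below the range where f is regular
    contribute O(N), and X tends to infinity.

    Lower bound. Colour n by the cell of length 2^-(d+1) which contains the
    fractional part of f(n). If a progression is monochromatic and r is a small
    multiple of X, then the difference of order d+1 of the floors is an integer
    of absolute value less than 1, hence zero ([calP_of_close_fracs]). Van
    der Waerden's theorem ([van_der_waerden]) supplies a monochromatic progression
    inside every dilated block x + s [0, V[, with V a constant. Letting x range over a
    positive proportion of [0, N] and s over [1, X / (7 V)] gives about N X
    blocks, and a pair (b, r) occurs in at most V (V+1) of them
    ([card_good_pairs_lower]).

    Regularity. The argument uses that g is eventually positive, decreasing,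
    tends to 0, satisfies g(x/2) <= 3 g(x) and is not smaller than 1/x^2. The
    first three follow from the growth of f, by repeated integration, and from
    the fact that elements of a Hardy field have an eventually constant sign.
    For the last two, h = g/g' belongs to the Hardy field, so h' is
    eventually on one side of -1. If h' > -1, then (x + C) g(x) is
    nonincreasing for a constant C, so x g(x) is bounded and
    f(x) = O(x^d log x), against the hypothesis. Therefore h' <= -1 and
    (x - C) g(x) is nondecreasing for a constant C ([top_slow]). As the constant
    3 is absolute, the constants of the theorem depend only on k and d. *)

(** * Differentiation near infinity *)

Lemma near_pinftyP (R : realType) (P : set R) :
  (\forall x \near +oo, P x) <-> exists a, forall x, a <= x -> P x.
Proof.
split=> [[a [_ aP]]|[a aP]]; first by exists (a + 1) => x ax; apply: aP; lra.
by exists a; split; [exact: num_real|move=> x /ltW; exact: aP].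
Qed.

Lemma near_pinfty_ge (R : realType) (a : R) : \forall x \near +oo, a <= x.
Proof. by apply/near_pinftyP; exists a. Qed.

Lemma near_natr (R : realType) (P : set R) :
  (\forall x \near +oo, P x) -> \forall N \near \oo, P N%:R.
Proof.
move=> /near_pinftyP[a aP]; exists (Num.truncn `|a|).+1 => // N /= aN; apply: aP.
rewrite (le_trans (ler_norm a)) // (le_trans (ltW (truncnS_gt _))) //.
by rewrite ler_nat.
Qed.

Lemma mean_value (R : realType) (u du : R -> R) (x y : R) : x <= y ->
  (forall z, x <= z <= y -> is_derive z (1 : R) u (du z)) ->
  exists2 z, x <= z <= y & u y - u x = du z * (y - x).
Proof.
move=> xy uD; have [||z] := @MVT_segment R u du x y xy.
- by move=> z; rewrite in_itv /= => /andP[xz zy]; apply: uD; rewrite !ltW.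
- apply: derivable_within_continuous => z; rewrite in_itv /= => zxy.
  by have := uD z zxy => /@ex_derive.
- by rewrite in_itv /= => zxy ->; exists z.
Qed.

Lemma nondecreasing_of_derive_ge0 (R : realType) (u du : R -> R) :
  (\forall x \near +oo, is_derive x (1 : R) u (du x)) ->
  (\forall x \near +oo, 0 <= du x) ->
  exists a, forall x y, a <= x -> x <= y -> u x <= u y.
Proof.
move=> /near_pinftyP[a uD] /near_pinftyP[b du0].
exists (Num.max a b) => x y; rewrite ge_max => /andP[ax bx] xy.
have [z /andP[xz zy] E] := @mean_value R u du x y xy
   (fun z Hz => uD z (le_trans ax (proj1 (andP Hz)))).
rewrite -subr_ge0 E mulr_ge0 ?subr_ge0 //; apply: du0; exact: le_trans xz.
Qed.

Lemma near_le_of_derive_le (R : realType) (u v du dv : R -> R) :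
  (\forall x \near +oo, is_derive x (1 : R) u (du x)) ->
  (\forall x \near +oo, is_derive x (1 : R) v (dv x)) ->
  (\forall x \near +oo, du x <= dv x) ->
  exists C, \forall x \near +oo, u x <= v x + C.
Proof.
move=> uD vD duv.
have [||a ha] := @nondecreasing_of_derive_ge0 R (v - u) (fun x => dv x - du x).
- by near=> x; apply: is_deriveB; near: x.
- by near=> x; rewrite subr_ge0; near: x.
exists (u a - v a); near=> x.
have : (v - u) a <= (v - u) x by apply: ha => //; near: x; exact: near_pinfty_ge.
rewrite /= !fctE; lra.
Unshelve. all: by end_near. Qed.

(** * Hardy fields *)

Section Hardy.
Variables (R : realType) (K : set (R -> R)).
Hypothesis KH : hardy_field K.

Lemma hardy_derive1 (u : R -> R) : K u ->
  K (derive1 u) /\ \forall x \near +oo, is_derive x (1 : R) u (derive1 u x).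
Proof.
move=> Ku; have [h Kh uh] := hardy_fieldD KH Ku.
split.
  apply: (hardy_field_germ KH) Kh; rewrite /germ_eq; near=> x.
  have -> // : derive1 u x = h x.
  rewrite derive1E; have xh : is_derive x (1 : R) u (h x) by near: x.
  exact: derive_val.
near=> x; rewrite derive1E.
have xh : is_derive x (1 : R) u (h x) by near: x.
by apply: DeriveDef => //; apply: ex_derive.
Unshelve. all: by end_near. Qed.

Lemma hardy_derive1n (u : R -> R) n : K u -> K (derive1n n u).
Proof. by move=> Ku; elim: n => // n IH; rewrite derive1nS; apply hardy_derive1. Qed.

(** A nonzero element is invertible, hence eventually nonvanishing; being
    eventually differentiable, it cannot change sign afterwards without taking
    the value 0. *)
Lemma hardy_sign (u : R -> R) : K u ->
  (\forall x \near +oo, 0 < u x) \/ (\forall x \near +oo, u x <= 0).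
Proof.
move=> Ku; have [u0|nu0] := pselect (germ_eq u (cst 0)).
  by right; near=> x; have -> // : u x = 0 by near: x.
have [h Kh /near_pinftyP[a ha]] := hardy_fieldV KH Ku nu0.
have [_ /near_pinftyP[b uD]] := hardy_derive1 Ku.
pose m := Num.max a b.
have um x : m <= x -> u x != 0.
  rewrite ge_max => /andP[ax _]; have := ha _ ax => /=.
  by case: eqP => // ->; rewrite mul0r => /eqP; rewrite eq_sym oner_eq0.
have cont x y : m <= x -> {within `[x, y], continuous u}.
  move=> mx; apply: derivable_within_continuous => z.
  rewrite in_itv /= => /andP[xz _].
  have bz : b <= z by apply: le_trans xz; apply: le_trans mx; rewrite le_max lexx orbT.
  by have := uD z bz => /@ex_derive.
have sgn x : m <= x -> 0 < u m * u x.
  move=> mx; rewrite lt_neqAle eq_sym mulf_neq0 ?um //=.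
  rewrite leNgt; apply/negP => neg.
  have [|c] := @IVT R u m x 0 mx (cont _ _ (lexx _)).
    case: (ltgtP (u m) 0) => um0.
    - have ux : 0 < u x by rewrite nmulr_rlt0 in neg.
      rewrite ge_min le_max (ltW um0) (ltW ux) /=; by rewrite ?orbT.
    - have ux : u x < 0 by rewrite pmulr_rlt0 in neg.
      rewrite ge_min le_max (ltW um0) (ltW ux) /=; by rewrite ?orbT.
    - by have := um _ (lexx m); rewrite um0 eqxx.
  rewrite in_itv /= => /andP[mc _] uc; by have := um _ mc; rewrite uc eqxx.
case: (ltP 0 (u m)) => u0.
  by left; apply/near_pinftyP; exists m => x /sgn; rewrite pmulr_rgt0.
right; apply/near_pinftyP; exists m => x /sgn H.
have um0 : u m < 0 by rewrite lt_neqAle u0 um.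
by rewrite ltW // -(nmulr_rgt0 _ um0).
Unshelve. all: by end_near. Qed.

End Hardy.

(** * Integrating growth bounds *)

Section Growth.
Variable R : realType.
Implicit Types u du : R -> R.

Lemma powln_ge1 (m : nat) (x : R) : 1 <= x -> 1 <= x ^+ m * (1 + ln x).
Proof.
move=> x1; rewrite -[leLHS]mulr1 ler_pM ?ler01 ?exprn_ege1 //.
by rewrite lerDl ln_ge0.
Qed.

Lemma is_derive_powln (c x : R) (m : nat) : 0 < x ->
  is_derive x (1 : R) (fun x : R => c * (x ^+ m.+1 * (1 + ln x)))
    (c * (m.+1%:R * x ^+ m * (1 + ln x) + x ^+ m)).
Proof.
move=> x0; have Dln := is_derive1_ln x0.
rewrite (_ : (fun _ => _) = cst c * ((@id R) ^+ m.+1 * (cst 1 + @ln R))); last first.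
  by apply/funext => y; rewrite !fctE.
apply: is_derive_eq.
rewrite /cst /= !fctE ?scaler0 ?addr0 /GRing.scale /= exprS.
field; exact: lt0r_neq0.
Qed.

Lemma is_derive_pow (c x : R) (m : nat) :
  is_derive x (1 : R) (fun x : R => c * x ^+ m.+1) (c * m.+1%:R * x ^+ m).
Proof.
rewrite (_ : (fun _ => _) = cst c * (@id R) ^+ m.+1); last first.
  by apply/funext => y; rewrite !fctE.
apply: is_derive_eq.
rewrite /cst /= !fctE ?scaler0 ?addr0 /GRing.scale /=; ring.
Qed.

(** The scale x^m (1 + ln x) is used instead of x^m ln x because it dominates
    the constants of integration, also for m = 0. *)
Lemma growth_upper u du (C : R) (m : nat) :
  (\forall x \near +oo, is_derive x (1 : R) u (du x)) ->
  (\forall x \near +oo, du x <= C * (x ^+ m * (1 + ln x))) ->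
  exists C', \forall x \near +oo, u x <= C' * (x ^+ m.+1 * (1 + ln x)).
Proof.
move=> uD duC.
have [||B uB] := @near_le_of_derive_le R u
  (fun x : R => `|C| * (x ^+ m.+1 * (1 + ln x))) du
  (fun x : R => `|C| * (m.+1%:R * x ^+ m * (1 + ln x) + x ^+ m)) uD.
- near=> x; apply: is_derive_powln; apply: (lt_le_trans ltr01).
  near: x; exact: near_pinfty_ge.
- near=> x; have x1 : 1 <= x by near: x; exact: near_pinfty_ge.
  have xm : 1 <= x ^+ m by rewrite exprn_ege1.
  have l0 := ln_ge0 x1.
  have pl := powln_ge1 m x1.
  apply: (@le_trans _ _ (C * (x ^+ m * (1 + ln x)))); first by near: x.
  apply: (@le_trans _ _ (`|C| * (x ^+ m * (1 + ln x)))).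
    by rewrite ler_wpM2r ?ler_norm //; lra.
  rewrite ler_wpM2l // -mulrA -natr1 mulrDl mul1r.
  have : 0 <= m%:R * (x ^+ m * (1 + ln x)) by rewrite mulr_ge0 //; lra.
  lra.
exists (`|C| + `|B|); near=> x.
have x1 : 1 <= x by near: x; exact: near_pinfty_ge.
have pl := powln_ge1 m.+1 x1.
have : u x <= `|C| * (x ^+ m.+1 * (1 + ln x)) + B by near: x.
move=> /le_trans; apply; rewrite mulrDl lerD2l.
by rewrite (le_trans (ler_norm B)) // ler_peMr.
Unshelve. all: by end_near. Qed.

Lemma growth_upper0 u du (C : R) :
  (\forall x \near +oo, is_derive x (1 : R) u (du x)) ->
  (\forall x \near +oo, x * du x <= C) ->
  exists C', \forall x \near +oo, u x <= C' * (1 + ln x).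
Proof.
move=> uD duC.
have [||B uB] := @near_le_of_derive_le R u (fun x : R => C * ln x) du
  (fun x : R => C * x^-1) uD.
- near=> x; have x0 : 0 < x.
    by apply: (lt_le_trans ltr01); near: x; exact: near_pinfty_ge.
  have Dln := is_derive1_ln x0.
  rewrite (_ : (fun _ => _) = cst C * @ln R); last by apply/funext.
  by apply: is_derive_eq; rewrite /cst /= scaler0 addr0.
- near=> x; have x0 : 0 < x.
    by apply: (lt_le_trans ltr01); near: x; exact: near_pinfty_ge.
  by rewrite ler_pdivlMr // mulrC; near: x.
exists (`|C| + `|B|); near=> x.
have x1 : 1 <= x by near: x; exact: near_pinfty_ge.
have l0 := ln_ge0 x1.
have : u x <= C * ln x + B by near: x.
move=> /le_trans; apply; rewrite mulrDl lerD //.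
  apply: (@le_trans _ _ (`|C| * ln x)); first by rewrite ler_wpM2r ?ler_norm.
  by rewrite ler_wpM2l //; lra.
rewrite (le_trans (ler_norm B)) // ler_peMr //; lra.
Unshelve. all: by end_near. Qed.

Lemma growth_lower u du (c : R) (m : nat) : 0 < c ->
  (\forall x \near +oo, is_derive x (1 : R) u (du x)) ->
  (\forall x \near +oo, c * x ^+ m <= du x) ->
  exists2 c', 0 < c' & \forall x \near +oo, c' * x ^+ m.+1 <= u x.
Proof.
move=> c0 uD duc; pose e : R := c / m.+1%:R.
have e0 : 0 < e by rewrite divr_gt0.
have [||B uB] := @near_le_of_derive_le R
  (fun x : R => e * x ^+ m.+1) u (fun x : R => e * m.+1%:R * x ^+ m) du _ uD.
- by near=> x; exact: is_derive_pow.
- by near=> x; rewrite divfK ?pnatr_eq0 //; near: x.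
exists (e / 2); first by rewrite divr_gt0.
near=> x.
have x1 : 1 <= x by near: x; exact: near_pinfty_ge.
have xB : 2 * `|B| / e <= x by near: x; exact: near_pinfty_ge.
have : e * x ^+ m.+1 <= u x + B by near: x.
have : x <= x ^+ m.+1 by rewrite exprS ler_peMr ?exprn_ege1 //; lra.
move=> /(le_trans xB); rewrite ler_pdivrMr // => H1 H2.
have := ler_norm B; rewrite -(ler_pM2l (ltr0n _ 2)) => H3.
lra.
Unshelve. all: by end_near. Qed.

End Growth.

(** * Derivatives of a function between x^d log x and x^(d+1) *)

(** The part of the regularity of f that holds beyond a threshold fixed once for
    all, as opposed to the estimates that compare g(N) with other values. *)
Record tame (R : realType) (f : R -> R) (d : nat) (a : R) : Prop := Tame {
  tame_derive : forall i (z : R), (i <= d)%N -> a <= z ->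
    is_derive z (1 : R) (derive1n i f) (derive1n i.+1 f z) ;
  tame_ge1 : forall z, a <= z -> 1 <= f z ;
  tame_derive_ge1 : forall z, a <= z -> 1 <= derive1n 1 f z ;
  tame_top_gt0 : forall z, a <= z -> 0 < derive1n d.+1 f z ;
  tame_top_nonincreasing : forall x y, a <= x -> x <= y ->
    derive1n d.+1 f y <= derive1n d.+1 f x
}.

Section Admissible.
Variables (R : realType) (K : set (R -> R)) (f : R -> R) (d : nat).
Hypotheses (KH : hardy_field K) (Kf : K f).
Hypothesis f_lower : prec (fun x => x ^+ d * ln x) f.
Hypothesis f_upper : prec f (fun x => x ^+ d.+1).

Lemma is_derive_derive1n i :
  \forall x \near +oo, is_derive x (1 : R) (derive1n i f) (derive1n i.+1 f x).
Proof. by have [_] := hardy_derive1 KH (hardy_derive1n KH i Kf). Qed.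

(** Otherwise, integrating i times would give f(x) = O(x^d log x). *)
Lemma derive1n_lower i C : (i <= d)%N ->
  ~ \forall x \near +oo, derive1n i f x <= C * (x ^+ (d - i) * (1 + ln x)).
Proof.
elim: i C => [|i IH] C id H; last first.
  have [C'] := growth_upper (is_derive_derive1n i) H.
  by rewrite subnSK //; apply: IH; exact: ltnW.
have fA : \forall x \near +oo, 2 * `|C| + 1 <= f x / (x ^+ d * ln x).
  by have /cvgryPge := f_lower; apply.
near (pinfty_nbhs R) => x.
have x1 : 1 <= x by near: x; exact: near_pinfty_ge.
have l1 : 1 <= ln x.
  have ex : expR 1 <= x by near: x; exact: near_pinfty_ge.
  by rewrite -[leLHS](@expRK R) ler_ln ?posrE ?expR_gt0 // (lt_le_trans (expR_gt0 1)).
have x0 : 0 < x ^+ d by rewrite exprn_gt0 //; lra.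
have : 2 * `|C| + 1 <= f x / (x ^+ d * ln x) by near: x.
rewrite ler_pdivlMr; last by rewrite mulr_gt0 //; lra.
have : f x <= C * (x ^+ (d - 0) * (1 + ln x)) by near: x.
rewrite subn0 => H1 H2; have := le_trans H2 H1; apply/negP; rewrite -ltNge.
apply: (@le_lt_trans _ _ (2 * `|C| * (x ^+ d * ln x))); last first.
  by rewrite ltr_pM2r ?ltrDl ?ltr01 // mulr_gt0 //; lra.
apply: (@le_trans _ _ (`|C| * (x ^+ d * (1 + ln x)))).
  by rewrite ler_wpM2r ?ler_norm // mulr_ge0 ?ltW //; lra.
have : 0 <= `|C| * x ^+ d * (ln x - 1) by rewrite !mulr_ge0 ?subr_ge0 // ltW.
lra.
Unshelve. all: by end_near. Qed.

Lemma derive1n_top_lower C : ~ \forall x \near +oo, x * derive1n d.+1 f x <= C.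
Proof.
move=> H; have [C' H'] := growth_upper0 (is_derive_derive1n d) H.
apply: (@derive1n_lower d C' (leqnn d)); near=> x.
by rewrite subnn expr0 mul1r; near: x.
Unshelve. all: by end_near. Qed.

(** Otherwise, integrating i times would give a lower bound for f of order x^(d+1). *)
Lemma derive1n_upper i c : (i <= d.+1)%N -> 0 < c ->
  ~ \forall x \near +oo, c * x ^+ (d.+1 - i) <= derive1n i f x.
Proof.
elim: i c => [|i IH] c id c0 H; last first.
  have [c' c'0] := growth_lower c0 (is_derive_derive1n i) H.
  by rewrite subnSK //; apply: IH c'0; exact: ltnW.
have fA : \forall x \near +oo, 2 / c <= x ^+ d.+1 / f x.
  by have /cvgryPge := f_upper; apply.
near (pinfty_nbhs R) => x.
have x0 : 0 < x ^+ d.+1.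
  by rewrite exprn_gt0 // (lt_le_trans ltr01) //; near: x; exact: near_pinfty_ge.
have H1 : c * x ^+ (d.+1 - 0) <= f x by near: x.
have f0 : 0 < f x by apply: lt_le_trans H1; rewrite mulr_gt0.
have : 2 / c <= x ^+ d.+1 / f x by near: x.
rewrite ler_pdivlMr // mulrAC ler_pdivrMr // => H2.
rewrite subn0 in H1; lra.
Unshelve. all: by end_near. Qed.

Local Notation g := (derive1n d.+1 f).

Lemma top_gt0 : \forall x \near +oo, 0 < g x.
Proof.
case: (hardy_sign KH (hardy_derive1n KH d.+1 Kf)) => // g0.
case: (@derive1n_top_lower 0); near=> x.
by apply: mulr_ge0_le0; near: x => //; exact: near_pinfty_ge.
Unshelve. all: by end_near. Qed.

(** Otherwise g would be nondecreasing, hence bounded below by a positive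
    constant. *)
Lemma top_deriv_lt0 : \forall x \near +oo, derive1n d.+2 f x < 0.
Proof.
have Kg := hardy_derive1n KH d.+1 Kf.
have Kg' := hardy_derive1n KH d.+2 Kf.
have no : ~ \forall x \near +oo, 0 <= derive1n d.+2 f x.
  move=> g'0; have [a ga] := nondecreasing_of_derive_ge0 (is_derive_derive1n d.+1) g'0.
  have /near_pinftyP[b gb] := top_gt0.
  pose m := Num.max a b.
  have gm : 0 < g m by apply: gb; rewrite le_max lexx orbT.
  apply: (@derive1n_upper d.+1 (g m)) => //.
  rewrite subnn; apply/near_pinftyP; exists m => x mx.
  rewrite expr0 mulr1; apply: ga => //; by rewrite le_max lexx.
have Kn : K (fun x => 0 - derive1n d.+2 f x).
  apply: (hardy_fieldB KH) => //.
  apply: (hardy_field_germ KH _ (hardy_fieldB KH (hardy_field1 KH) (hardy_field1 KH))).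
  by near=> x; rewrite subrr.
case: (hardy_sign KH Kn) => H; [|case: no].
  by near=> x; rewrite -oppr_gt0 -sub0r; near: x.
by near=> x; rewrite -oppr_le0 -sub0r; near: x.
Unshelve. all: by end_near. Qed.

Lemma top_nonincreasing : exists a, forall x y, a <= x -> x <= y -> g y <= g x.
Proof.
have [||a ga] := @nondecreasing_of_derive_ge0 R (- g) (fun x => - derive1n d.+2 f x).
- by near=> x; apply: is_deriveN; near: x; exact: is_derive_derive1n.
- by near=> x; rewrite oppr_ge0 ltW //; near: x; exact: top_deriv_lt0.
by exists a => x y ax xy; have := ga _ _ ax xy; rewrite !fctE lerN2.
Unshelve. all: by end_near. Qed.

Lemma top_small (e : R) : 0 < e -> \forall x \near +oo, g x <= e.
Proof.
move=> e0; have [a ga] := top_nonincreasing.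
have [[x ax gx]|ng] := pselect (exists2 x, a <= x & g x <= e).
  by apply/near_pinftyP; exists x => y xy; apply: le_trans gx; apply: ga.
case: (@derive1n_upper d.+1 e) => //; apply/near_pinftyP; exists a => x ax.
rewrite subnn expr0 mulr1 leNgt; apply/negP => gx; apply: ng.
by exists x => //; exact: ltW.
Qed.

(** With h = g/g' one has ((x - C) g)' = g' (h + x - C), and g' < 0, so that the
    monotonicity of (x - C) g is decided by comparing h with C - x. This follows
    from the sign of h' + 1, an element of the Hardy field. The logarithmic slope
    x g'/g would not do, as the identity function need not belong to that field. *)
Lemma top_slow : exists C a : R, forall x y, a <= x -> x <= y ->
  (x - C) * g x <= (y - C) * g y.
Proof.
have Kg := hardy_derive1n KH d.+1 Kf.
have Kg' := hardy_derive1n KH d.+2 Kf.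
have g'0 := top_deriv_lt0.
have [|j Kj g'j] := hardy_fieldV KH Kg'.
  move=> E; near (pinfty_nbhs R) => x.
  have : derive1n d.+2 f x < 0 by near: x.
  suff -> : derive1n d.+2 f x = 0 by rewrite ltxx.
  by near: x.
pose h x := g x * j x.
have Kh : K h := hardy_fieldM KH Kg Kj.
have hg' : \forall x \near +oo, h x * derive1n d.+2 f x = g x.
  near=> x; rewrite /h -mulrA (mulrC (j x)).
  by rewrite (near g'j x) ?mulr1.
have [Kh' hD] := hardy_derive1 KH Kh.
(* The constant -1 is written 1 - 1 - 1, from the closure properties at hand. *)
have K1 : K (fun x => derive1 h x - (1 - 1 - 1)).
  by apply: (hardy_fieldB KH) Kh' _; apply: (hardy_fieldB KH); [apply: (hardy_fieldB KH)|]; exact: (hardy_field1 KH).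
have linD (C x : R) : is_derive x (1 : R) g (derive1n d.+2 f x) ->
    is_derive x (1 : R) (fun x => (x - C) * g x) (g x + (x - C) * derive1n d.+2 f x).
  move=> gD; rewrite (_ : (fun _ => _) = ((@id R) - cst C) * g); last by apply/funext.
  apply: is_derive_eq; rewrite !fctE /cst /= subr0 /GRing.scale /= mulr1; ring.
have idD (c x : R) : is_derive x (1 : R) (fun x : R => c * x) c.
  have := is_derive_pow c x 0; rewrite expr0 !mulr1.
  by under [X in is_derive _ _ X _ -> _]eq_fun do rewrite expr1.
have gD := is_derive_derive1n d.+1.
case: (hardy_sign KH K1) => s.
  (* Here (x + C) g is nonincreasing, and x g(x) would be bounded. *)
  have [||C hC] := @near_le_of_derive_le R (fun x => -1 * x) h (fun=> -1) (derive1 h) _ hD.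
  - by near=> x; exact: idD.
  - near=> x; have : 0 < derive1 h x - (1 - 1 - 1) by near: x.
    lra.
  have [||a ga] := @nondecreasing_of_derive_ge0 R (- (fun x => (x - - C) * g x))
     (fun x => - (g x + (x - - C) * derive1n d.+2 f x)).
  - by near=> x; apply: is_deriveN; apply: linD; near: x.
  - near=> x; rewrite oppr_ge0 opprK.
    have <- : h x * derive1n d.+2 f x = g x by near: x.
    rewrite -mulrDl mulr_ge0_le0 //; last by rewrite ltW //; near: x.
    have : -1 * x <= h x + C by near: x.
    lra.
  case: (@derive1n_top_lower (`|C| * 1 + (a + C) * g a)); near=> x.
  have ax : a <= x by near: x; exact: near_pinfty_ge.
  have := ga _ _ (lexx a) ax; rewrite !fctE lerN2 !opprK mulrDl => H.
  have g1 : g x <= 1 by near: x; exact: top_small.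
  have g0 : 0 < g x by near: x; exact: top_gt0.
  have : - C * g x <= `|C| * 1.
    apply: (@le_trans _ _ (`|C| * g x)); last by rewrite ler_wpM2l.
    by rewrite ler_wpM2r ?(ltW g0) // -normrN ler_norm.
  lra.
(* Here h <= C - x, so (x - C) g has a nonnegative derivative. *)
have [||C hC] := @near_le_of_derive_le R h (fun x => -1 * x) (derive1 h) (fun=> -1) hD.
- by near=> x; exact: idD.
- near=> x; have : derive1 h x - (1 - 1 - 1) <= 0 by near: x.
  lra.
exists C.
have [||a ga] := @nondecreasing_of_derive_ge0 R (fun x => (x - C) * g x)
   (fun x => g x + (x - C) * derive1n d.+2 f x).
- by near=> x; apply: linD; near: x.
- near=> x; have <- : h x * derive1n d.+2 f x = g x by near: x.
  rewrite -mulrDl mulr_le0 //; last by rewrite ltW //; near: x.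
  have : h x <= -1 * x + C by near: x.
  lra.
by exists a.
Unshelve. all: by end_near. Qed.

(** Between x/2 and x the factor y - C varies by a factor at most 3 when x is
    large compared with C. *)
Lemma top_doubling : \forall x \near +oo, forall y,
  x <= 2 * y -> y <= x -> 0 < g x /\ g y <= 3 * g x.
Proof.
have [C [a ga]] := top_slow; have /near_pinftyP[b gb] := top_gt0.
near=> x => y xy yx.
have xa : 2 * a <= x by near: x; exact: near_pinfty_ge.
have xb : 2 * `|b| <= x by near: x; exact: near_pinfty_ge.
have xC : 4 * `|C| + 1 <= x by near: x; exact: near_pinfty_ge.
have g0 : 0 < g x by apply: gb; have := ler_norm b; have := normr_ge0 b; lra.
split=> //.
have := ga y x ltac:(lra) yx; have := ler_norm C; have := ler_norm (- C).
rewrite normrN => C1 C2 H.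
have yC : 0 < y - C by lra.
rewrite -(ler_pM2l yC) (le_trans H) // mulrCA mulrA ler_pM2r //; lra.
Unshelve. all: by end_near. Qed.

(** As (x - C) g(x) is bounded below by a positive constant, x^2 g(x) tends to
    infinity. This is what makes X at most N. *)
Lemma top_quadratic (A : R) : \forall x \near +oo, A <= x ^+ 2 * g x.
Proof.
have [C [a ga]] := top_slow; have /near_pinftyP[b gb] := top_gt0.
pose m := Num.max (Num.max a b) (C + 1).
have [am bm Cm] : [/\ a <= m, b <= m & C + 1 <= m].
  by rewrite /m !le_max !lexx !orbT.
have c0 : 0 < (m - C) * g m by rewrite mulr_gt0 ?gb //; lra.
near=> x.
have mx : m <= x by near: x; exact: near_pinfty_ge.
have x1 : 1 <= x by near: x; exact: near_pinfty_ge.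
have xC : `|C| <= x by near: x; exact: near_pinfty_ge.
have xA : 2 * `|A| / ((m - C) * g m) <= x by near: x; exact: near_pinfty_ge.
have g0 : 0 < g x by apply: gb; lra.
have H := ga m x am mx.
have H2 : (m - C) * g m <= 2 * x * g x.
  rewrite (le_trans H) // ler_pM2r //; have := ler_norm (- C); rewrite normrN; lra.
rewrite ler_pdivrMr // in xA.
have := ler_wpM2l (le_trans ler01 x1) H2.
have := ler_norm A; rewrite expr2; lra.
Unshelve. all: by end_near. Qed.

Lemma fun_ge1 : (0 < d)%N ->
  \forall x \near +oo, 1 <= f x /\ 1 <= derive1n 1 f x.
Proof.
move=> d0.
have K1 i : K (fun x => derive1n i f x - 1).
  apply: (hardy_fieldB KH); [exact: (hardy_derive1n KH i Kf)|exact: (hardy_field1 KH)].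
have ge1 i : (i <= d)%N -> \forall x \near +oo, 1 <= derive1n i f x.
  move=> id; case: (hardy_sign KH (K1 i)) => H.
    by near=> x; rewrite -subr_ge0 ltW //; near: x.
  case: (@derive1n_lower i 1 id); near=> x.
  have x1 : 1 <= x by near: x; exact: near_pinfty_ge.
  have fx : derive1n i f x - 1 <= 0 by near: x.
  by rewrite mul1r; apply: le_trans (powln_ge1 _ x1); rewrite -subr_le0.
have := ge1 0%N (leq0n d); have := ge1 1%N d0 => H1 H0.
near=> x; split; near: x => //.
Unshelve. all: by end_near. Qed.

Lemma tame_threshold : (0 < d)%N -> exists a, tame f d a.
Proof.
move=> d0; have /near_pinftyP[a1 H1] := fun_ge1 d0.
have [a2 H2] := top_nonincreasing; have /near_pinftyP[a3 H3] := top_gt0.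
have [a4 H4] : exists a : R, forall i (z : R), (i <= d)%N -> a <= z ->
    is_derive z (1 : R) (derive1n i f) (derive1n i.+1 f z).
  elim: d => [|n [b Hb]].
    have /near_pinftyP[b Hb] := is_derive_derive1n 0.
    by exists b => i z; rewrite leqn0 => /eqP->; exact: Hb.
  have /near_pinftyP[c Hc] := is_derive_derive1n n.+1.
  exists (Num.max b c) => i z; rewrite ge_max leq_eqVlt => /orP[/eqP->|ni] /andP[bz cz].
    exact: Hc.
  exact: Hb.
exists (Num.max (Num.max a1 a2) (Num.max a3 a4)); split.
- by move=> i z id; rewrite !ge_max => /andP[_ /andP[_ ?]]; exact: H4.
- by move=> z; rewrite !ge_max => /andP[/andP[/H1[]]].
- by move=> z; rewrite !ge_max => /andP[/andP[/H1[]]].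
- by move=> z; rewrite !ge_max => /andP[_ /andP[/H3]].
- by move=> x y; rewrite !ge_max => /andP[/andP[_ ?] _]; exact: H2.
Qed.

End Admissible.

(** * Van der Waerden's theorem *)

Definition mono_ap (C : Type) (c : nat -> C) (k a r : nat) : Prop :=
  (0 < r)%N /\ forall j, (j <= k)%N -> c (a + j * r)%N = c a.

(** Each colour of [cs] is the colour of a monochromatic progression with k+1 terms
    whose continuation by one more term is x. *)
Definition focused (C : eqType) (c : nat -> C) (k x : nat) (cs : seq C) : Prop :=
  forall y, y \in cs -> exists a r,
    [/\ (0 < r)%N, (a + k.+1 * r)%N = x & forall j, (j <= k)%N -> c (a + j * r)%N = y].

(** The bound on the difference r excludes, for progressions with a single term,
    differences unrelated to the interval. *)
Definition vdw_bound (C : Type) (k W : nat) : Prop :=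
  forall c : nat -> C, exists a r,
    [/\ (r <= W)%N, (a + k * r < W)%N & mono_ap c k a r].

(** Colour focusing. Cut the integers into blocks of length n and colour a block
    by the colours of its points: finitely many colours suffice, so there is a
    monochromatic progression of k+1 blocks, with difference D n. Inside the
    first block lie s progressions focused at x; adding D n to their differences
    focuses them at the point corresponding to x in the block that continues the
    progression of blocks, and the points corresponding to x form one more
    progression with the same focus. Its colour is new unless one of the
    progressions inside the block extends by its focus. *)
Lemma color_focusing (C : finType) (k : nat) :
  (forall D : finType, exists W, vdw_bound D k W) ->
  forall s, exists n, forall c : nat -> C,
    (exists a r, (a + k.+1 * r < n)%N /\ mono_ap c k.+1 a r) \/
    (exists x cs, [/\ (x < n)%N, uniq cs, size cs = s & focused c k x cs]).
Proof.
move=> vdwk; elim=> [|s [n IHn]].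
  by exists 1%N => c; right; exists 0%N, [::].
have [W HW] := vdwk {ffun 'I_n -> C}.
exists (2 * W * n)%N => c.
have [B [D [DW BDW [D0 monoB]]]] := HW (fun m => [ffun i : 'I_n => c (m * n + i)%N]).
have colE j i : (j <= k)%N -> (i < n)%N ->
    c ((B + j * D) * n + i)%N = c (B * n + i)%N.
  by move=> jk lin; have /ffunP/(_ (Ordinal lin)) := monoB j jk; rewrite !ffunE.
have endB x : (x < n)%N -> ((B + k.+1 * D) * n + x < 2 * W * n)%N.
  move=> xn; apply: (@leq_trans ((B + k.+1 * D).+1 * n)%N).
    by rewrite mulSn addnC ltn_add2r.
  rewrite leq_mul2r; apply/orP; right; nia.
have inB x : (x < n)%N -> (B * n + x < 2 * W * n)%N.
  by move=> /endB; apply: leq_ltn_trans; rewrite leq_add2r leq_mul2r leq_addr orbT.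
case: (IHn (fun i => c (B * n + i)%N)) => [[a [r [arn [r0 mono]]]]|].
  left; exists (B * n + a)%N, r; split; first by rewrite -addnA inB.
  by split=> // j jk; rewrite -addnA mono.
case=> x [cs [xn ucs scs foc]].
have [xcs|xcs] := boolP (c (B * n + x)%N \in cs).
  have [a [r [r0 arx mono]]] := foc _ xcs.
  left; exists (B * n + a)%N, r; split; first by rewrite -addnA arx inB.
  split=> // j; rewrite leq_eqVlt => /orP[/eqP->|jk].
    by rewrite -addnA arx; have := mono 0%N isT; rewrite mul0n addn0 => ->.
  rewrite -addnA mono //.
  by have := mono 0%N isT; rewrite mul0n addn0 => ->.
right; exists ((B + k.+1 * D) * n + x)%N, (c (B * n + x)%N :: cs).
split; rewrite ?endB //= ?xcs ?scs // => y; rewrite inE => /orP[/eqP->|ycs].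
  exists (B * n + x)%N, (D * n)%N; split; [nia|nia|move=> j jk].
  by rewrite -(colE j x) //; congr c; nia.
have [a [r [r0 arx mono]]] := foc _ ycs.
exists (B * n + a)%N, (r + D * n)%N; split; [nia|nia|move=> j jk].
have arn : (a + j * r < n)%N by apply: leq_ltn_trans xn; rewrite -arx; nia.
by rewrite -(mono j jk) -(colE j _ jk arn); congr c; nia.
Qed.

(** Focusing with more colours than exist is impossible. *)
Theorem van_der_waerden (k : nat) (C : finType) : exists W, vdw_bound C k W.
Proof.
elim: k C => [|k IHk] C.
  by exists 1%N => c; exists 0%N, 1%N; split=> //; split=> // j; rewrite leqn0 => /eqP->.
have [n Hn] := color_focusing C IHk #|C|.+1.
exists n => c; case: (Hn c) => [[a [r [arn mono]]]|[x [cs [_ ucs scs _]]]].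
  by exists a, r; split=> //; nia.
by have := max_card [in cs]; rewrite (card_uniqP ucs) scs ltnn.
Qed.

(** * Finite differences *)

Definition fdiff (V : zmodType) (u : nat -> V) (n : nat) : V := u n.+1 - u n.

Lemma eq_iter_fdiff (V : zmodType) (u v : nat -> V) m n :
  (forall i, (i <= m)%N -> u (n + i)%N = v (n + i)%N) ->
  iter m (@fdiff V) u n = iter m (@fdiff V) v n.
Proof.
elim: m n => [|m IH] n uv; first by have := uv 0%N isT; rewrite addn0.
rewrite !iterS /fdiff !IH // => i im; first exact: uv (leqW im).
by rewrite addSnnS uv.
Qed.

Lemma iter_fdiffB (V : zmodType) (u v : nat -> V) m n :
  iter m (@fdiff V) (fun i => u i - v i) n
  = iter m (@fdiff V) u n - iter m (@fdiff V) v n.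
Proof.
elim: m n => // m IH n; rewrite !iterS /fdiff !IH.
by rewrite !opprD [LHS]addrACA.
Qed.

Lemma iter_fdiff_intr (R : pzRingType) (a : nat -> int) m n :
  (iter m Delta1 a n)%:~R = iter m (@fdiff R) (fun i => (a i)%:~R) n.
Proof. by elim: m n => // m IH n; rewrite !iterS /Delta1 /fdiff rmorphB /= !IH. Qed.

Lemma iter_fdiff_bound (R : realDomainType) (u : nat -> R) (B : R) m n :
  (forall i, (i <= m)%N -> `|u (n + i)%N| <= B) ->
  `|iter m (@fdiff R) u n| <= 2 ^+ m * B.
Proof.
elim: m n => [|m IH] n uB.
  by rewrite expr0 mul1r; have := uB 0%N isT; rewrite addn0.
rewrite iterS {1}/fdiff (le_trans (ler_normB _ _)) //.
have H1 : `|iter m (@fdiff R) u n.+1| <= 2 ^+ m * B.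
  by apply: IH => i im; rewrite addSnnS uB.
have H2 : `|iter m (@fdiff R) u n| <= 2 ^+ m * B.
  by apply: IH => i im; rewrite uB // leqW.
rewrite exprS; lra.
Qed.

Lemma iter_fdiff_eq0 (V : zmodType) (a : nat -> V) m k :
  (forall n, (n + m < k)%N -> iter m.+1 (@fdiff V) a n = 0) ->
  forall n, (n + m <= k)%N -> iter m (@fdiff V) a n = iter m (@fdiff V) a 0.
Proof.
move=> H; elim=> // n IH nk; rewrite -(IH (ltnW nk)).
by apply/eqP; rewrite -subr_eq0; apply/eqP; exact: H.
Qed.

Definition shift_diff (R : zmodType) (r : R) (u : R -> R) (x : R) := u (x + r) - u x.

Lemma iter_fdiff_shift (R : pzRingType) (r x : R) (u : R -> R) m n :
  iter m (@fdiff R) (fun j => u (x + j%:R * r)) n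
  = iter m (shift_diff r) u (x + n%:R * r).
Proof.
elim: m n => // m IH n; rewrite !iterS /fdiff /shift_diff !IH.
by congr (iter m _ u _ - _); rewrite -natr1 mulrDl mul1r addrA.
Qed.

(** The family [phi] stands for a function and its successive derivatives: the
    induction applies the mean value theorem to the last one, and replaces the
    others by their first differences. *)
Lemma iter_shift_diff_bound (R : realType) (phi : nat -> R -> R)
    (r a b c1 c2 : R) m x : 0 <= r ->
  (forall i z, (i < m)%N -> a <= z -> is_derive z (1 : R) (phi i) (phi i.+1 z)) ->
  (forall z, a <= z -> z <= b -> c1 <= phi m z <= c2) ->
  a <= x -> x + m%:R * r <= b ->
  c1 * r ^+ m <= iter m (shift_diff r) (phi 0%N) x <= c2 * r ^+ m.
Proof.
move=> r0; elim: m phi b c1 c2 => [|m IH] phi b c1 c2 phiD phib ax xb.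
  by rewrite expr0 !mulr1; apply: phib => //; rewrite mul0r addr0 in xb.
rewrite iterSr !exprS !(mulrA _ r).
apply: (IH (fun i => shift_diff r (phi i)) (b - r)) => //.
- move=> i z im az; rewrite /shift_diff.
  have D1 := phiD _ _ (leqW im) az.
  have D2 : is_derive (z + r) (1 : R) (phi i) (phi i.+1 (z + r)).
    by apply: phiD; [exact: leqW|lra].
  have D3 : is_derive z (1 : R) (phi i \o (fun y => y + r)) (phi i.+1 (z + r)).
    have D4 : is_derive z (1 : R) (fun y : R => y + r) 1.
      rewrite (_ : (fun _ => _) = @id R + cst r); last by apply/funext.
      by apply: is_derive_eq; rewrite addr0.
    by rewrite -[X in is_derive _ _ _ X]mulr1; exact: is_derive1_comp.
  exact: (is_deriveB D3 D1).
- move=> z az zb; rewrite /shift_diff.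
  have [w /andP[zw wz] ->] := @mean_value R (phi m) (phi m.+1) z (z + r) ltac:(lra)
    (fun w Hw => phiD _ _ (ltnSn m) (le_trans az (proj1 (andP Hw)))).
  have /andP[H1 H2] := phib w ltac:(lra) ltac:(lra).
  by rewrite (addrC z) addrK !ler_wpM2r.
- by move: xb; rewrite -natr1; lra.
Qed.

(** * Progressions as pairs *)

Definition prog (k b r : nat) : seq nat := [seq (b + j * r)%N | j <- iota 0 k].

Definition prog_set (k N : nat) (p : 'I_N.+1 * 'I_N.+1) : {set 'I_N.+1} :=
  [set i : 'I_N.+1 | nat_of_ord i \in prog k p.1 p.2]%SET.

Definition good_pairs (R : realType) (f : R -> R) (n0 k d N : nat) :
    {set 'I_N.+1 * 'I_N.+1} :=
  [set p : 'I_N.+1 * 'I_N.+1 |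
    [&& (n0 <= p.1)%N, (0 < p.2)%N, (p.1 + k.-1 * p.2 <= N)%N
      & is_calP k d [seq Num.floor (f n%:R) | n <- prog k p.1 p.2]]]%SET.

Lemma size_prog k b r : size (prog k b r) = k.
Proof. by rewrite size_map size_iota. Qed.

Lemma nth_prog k b r j : (j < k)%N -> nth 0%N (prog k b r) j = (b + j * r)%N.
Proof. by move=> jk; rewrite (nth_map 0%N) ?size_iota // nth_iota. Qed.

Lemma prog_sorted k b r : (0 < r)%N -> sorted ltn (prog k b r).
Proof.
move=> r0; rewrite sorted_map; apply: sub_sorted (iota_ltn_sorted 0 k).
by move=> i j /= ij; rewrite ltn_add2l ltn_pmul2r.
Qed.

Lemma elements_sorted N (P : {set 'I_N.+1}) : sorted ltn (elements P).
Proof.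
rewrite /elements /enum_mem -enumT sorted_map.
apply: sorted_filter; first by move=> y x z; apply: ltn_trans.
by rewrite -sorted_map val_enum_ord iota_ltn_sorted.
Qed.

Lemma mem_elements N (P : {set 'I_N.+1}) (i : 'I_N.+1) :
  (nat_of_ord i \in elements P) = (i \in P).
Proof. by rewrite /elements (mem_map val_inj) mem_enum. Qed.

Lemma elements_prog_set k N (p : 'I_N.+1 * 'I_N.+1) :
  (0 < p.2)%N -> (p.1 + k.-1 * p.2 <= N)%N -> elements (prog_set k p) = prog k p.1 p.2.
Proof.
move=> r0 pN; apply: (irr_sorted_eq ltn_trans ltnn (elements_sorted _) (prog_sorted _ _ r0)).
move=> n; apply/idP/idP => [/mapP[i]|np].
  by rewrite mem_enum inE => ip ->.
have nN : (n < N.+1)%N.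
  move: np => /mapP[j]; rewrite mem_iota add0n => jk ->; rewrite ltnS.
  apply: leq_trans pN; rewrite leq_add2l leq_mul2r; apply/orP; right; lia.
by rewrite -[n]/(nat_of_ord (Ordinal nN)) mem_elements inE.
Qed.

Lemma prog_calP k b r : (0 < b)%N -> (0 < r)%N -> is_calP k 1 [seq n%:Z | n <- prog k b r].
Proof.
move=> b0 r0; apply/and4P; split.
- by rewrite !size_map size_iota.
- by apply/allP => ? /mapP[n /mapP[j _ ->] ->]; rewrite ltz_nat addn_gt0 b0.
- by rewrite sorted_map; apply: sub_sorted (prog_sorted k b r0).
- apply/forallP => n; rewrite /= /Delta1.
  have nk := ltn_ord n.
  have E j : (j < k)%N -> nth 0 [seq n%:Z | n <- prog k b r] j = (b + j * r)%N%:Z.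
    by move=> jk; rewrite (nth_map 0%N) ?size_prog // nth_prog.
  rewrite !E; lia.
Qed.

(** A constant first difference determines every term from the first two. *)
Lemma calP1_prog k (e : seq nat) : (2 <= k)%N -> sorted ltn e ->
  is_calP k 1 [seq n%:Z | n <- e] ->
  exists b r, (0 < r)%N /\ e = prog k b r.
Proof.
move=> k2 se /and4P[]; rewrite size_map => /eqP ek _ _ /forallP D.
have r0 : (nth 0 e 0 < nth 0 e 1)%N.
  by apply: (sorted_ltn_nth ltn_trans 0%N se) => //; rewrite inE ek; lia.
exists (nth 0 e 0)%N, (nth 0 e 1 - nth 0 e 0)%N; split; first by rewrite subn_gt0.
apply: (@eq_from_nth _ 0%N); rewrite ?size_prog // ek => i ik; rewrite nth_prog //.
elim: i ik => [|i IH] ik; first by rewrite addn0.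
have ik' : (i < k - 1)%N by lia.
have := D (Ordinal ik'); rewrite /= /Delta1 !(nth_map 0%N) ?ek; lia.
Qed.

Lemma counted_apsE (R : realType) (f : R -> R) (n0 k d N : nat) :
  (0 < n0)%N -> (2 <= k)%N ->
  counted_aps f n0 k d N = [set prog_set k p | p in good_pairs f n0 k d N]%SET.
Proof.
move=> n00 k2; apply/setP => P; apply/idP/imsetP => [|[p]]; rewrite inE.
  move=> /and3P[/forall_inP n0P ap fP].
  have [b [r [r0 E]]] := calP1_prog k2 (elements_sorted P) ap.
  have inP j : (j < k)%N -> exists2 i : 'I_N.+1, i \in P & nat_of_ord i = (b + j * r)%N.
    move=> jk; have : (b + j * r)%N \in elements P.
      by rewrite E; apply: map_f; rewrite mem_iota.
    by move=> /mapP[i]; rewrite mem_enum => iP ->; exists i.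
  have [i0 i0P i0E] := inP 0%N (ltnW k2).
  have [i1 i1P i1E] := inP k.-1 ltac:(lia).
  have bN : (b < N.+1)%N by have := ltn_ord i0; lia.
  have rN : (r < N.+1)%N by have := ltn_ord i1; nia.
  exists (Ordinal bN, Ordinal rN).
    rewrite inE /= r0 -E fP andbT /=; apply/andP; split.
      by have := n0P _ i0P; rewrite i0E addn0.
    by rewrite -i1E -ltnS.
  by apply/setP => i; rewrite inE /= -E mem_elements.
move=> /and4P[n0p r0 pN fp] ->.
rewrite inE; apply/and3P; split; rewrite ?elements_prog_set ?prog_calP //; last lia.
apply/forall_inP => i; rewrite inE => /mapP[j _ ->]; lia.
Qed.

Lemma card_counted_aps (R : realType) (f : R -> R) (n0 k d N : nat) :
  (0 < n0)%N -> (2 <= k)%N ->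
  #|counted_aps f n0 k d N| = #|good_pairs f n0 k d N|.
Proof.
move=> n00 k2; rewrite counted_apsE // card_in_imset // => p q.
rewrite !inE => /and4P[_ p0 pN _] /and4P[_ q0 qN _] pq.
have := elements_prog_set p0 pN; rewrite pq elements_prog_set // => E.
have E0 := congr1 (fun s => nth 0 s 0)%N E.
have E1 := congr1 (fun s => nth 0 s 1)%N E.
rewrite !nth_prog in E0 E1; try lia.
by case: p q E0 E1 {p0 pN q0 qN pq E} => [p1 p2] [q1 q2] /= E0 E1; congr pair; apply: val_inj => /=; lia.
Qed.

(** * Progressions with polynomial floors *)

Section Tame.
Variables (R : realType) (f : R -> R) (d k : nat) (a : R).
Hypothesis fa : tame f d a.
Hypothesis dk : (d + 2 <= k)%N.
Local Notation g := (derive1n d.+1 f).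
Variables (N b r : nat).
Hypotheses (ab : a <= b%:R) (r0 : (0 < r)%N) (pN : (b + k.-1 * r <= N)%N).

Local Notation F := (fun j : nat => f (b + j * r)%N%:R).
Local Notation fl := (fun j : nat => Num.floor (f (b + j * r)%N%:R)).
Local Notation fr := (fun j : nat => F j - (fl j)%:~R).
Local Notation s := [seq Num.floor (f n%:R) | n <- prog k b r].

Lemma nth_floors j : (j < k)%N -> nth 0 s j = fl j.
Proof. by move=> jk; rewrite (nth_map 0%N) ?size_prog ?nth_prog. Qed.

Lemma iter_Delta1_floors m n : (n + m < k)%N ->
  iter m Delta1 (nth 0 s) n = iter m Delta1 fl n.
Proof.
move=> nmk; apply: (@eq_iter_fdiff int) => i im.
by rewrite (nth_map 0%N) ?size_prog ?nth_prog //; lia.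
Qed.

Lemma iter_fdiff_prog_bound (c : R) n : (n + d.+1 < k)%N ->
  g b%:R <= c ->
  g N%:R * r%:R ^+ d.+1 <= iter d.+1 (@fdiff R) F n <= c * r%:R ^+ d.+1.
Proof.
move=> nk gc.
have -> : F = fun j => f (b%:R + j%:R * r%:R).
  by apply/funext => j; rewrite natrD natrM.
rewrite iter_fdiff_shift.
apply: (@iter_shift_diff_bound R (fun i => derive1n i f) r%:R b%:R N%:R) => //.
- by move=> i z im az; apply: (tame_derive fa) => //; exact: le_trans az.
- move=> z bz zN; rewrite (le_trans _ gc) ?andbT.
    by apply: (tame_top_nonincreasing fa) => //; exact: le_trans bz.
  exact: (tame_top_nonincreasing fa).
- by rewrite lerDl mulr_ge0.
- by rewrite -!natrM -!natrD ler_nat; nia.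
Qed.

Lemma frac_bounds j : 0 <= fr j < 1.
Proof. by rewrite subr_ge0 floor_le ltrBlDl -intrD1 floorD1_gt. Qed.

(** The difference of order d+1 of the floors at index 0 is the difference of two
    entries of the constant sequence; two entries exist because k >= d+2. *)
Lemma good_small_step : is_calP k d s -> g N%:R * r%:R ^+ d.+1 <= 2 ^+ d.+1.
Proof.
move=> /and4P[_ _ _ /forallP D].
have kd : (1 < k - d)%N by lia.
have D0 : iter d.+1 Delta1 fl 0 = 0.
  rewrite -iter_Delta1_floors ?iterS; last lia.
  by rewrite /Delta1 (eqP (D (Ordinal kd))) /= subrr.
have /andP[H _] := @iter_fdiff_prog_bound (g b%:R) 0 ltac:(lia) (lexx _).
have E : iter d.+1 (@fdiff R) fr 0 = iter d.+1 (@fdiff R) F 0.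
  by rewrite iter_fdiffB -iter_fdiff_intr D0 subr0.
apply: le_trans H _; rewrite -E (le_trans (ler_norm _)) //.
rewrite -[leRHS]mulr1; apply: iter_fdiff_bound => i _.
by have /andP[f0 /ltW f1] := frac_bounds (0 + i); rewrite ger0_norm.
Qed.

(** The difference of order d+1 of the values of f lies in [0, 1/2[, and that of
    the fractional parts in [-1/2, 1/2], being a difference of order d of numbers
    bounded by 2^-(d+1). Their difference is an integer, hence 0. *)
Lemma calP_of_close_fracs (c : R) : g b%:R <= c -> c * r%:R ^+ d.+1 < 2^-1 ->
  (forall j, (j.+1 < k)%N -> `|fr j.+1 - fr j| <= (2 ^+ d.+1)^-1) ->
  is_calP k d s.
Proof.
move=> gc cr close.
have aj j : a <= (b + j * r)%N%:R.
  by apply: le_trans ab _; rewrite ler_nat leq_addr.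
have Fj j : F j + 1 <= F j.+1.
  have [||z /andP[z1 _]] := @mean_value R f (derive1n 1 f) (b + j * r)%N%:R (b + j.+1 * r)%N%:R.
  - by rewrite ler_nat; nia.
  - move=> z /andP[z1 _]; apply: (@tame_derive _ _ _ _ fa 0%N) => //.
    exact: le_trans z1.
  have := tame_derive_ge1 fa (le_trans (aj j) z1) => g1 E.
  rewrite addrC -lerBrDr E -[leLHS]mulr1 ler_pM //.
  rewrite -natrB; last nia.
  by rewrite (ler_nat _ 1); nia.
apply/and4P; split.
- by rewrite size_map size_prog.
- apply/allP => ? /mapP[? /mapP[j _ ->] ->].
  by rewrite floor_gt0 (tame_ge1 fa).
- apply/(sortedP 0) => i; rewrite size_map size_prog => ik.
  rewrite !nth_floors ?(ltnW ik) //.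
  apply: (@lt_le_trans _ _ (fl i + 1)); first by rewrite ltrDl.
  rewrite floor_ge_int intrD; apply: le_trans (Fj i).
  by rewrite lerD2r floor_le.
- apply/forallP => n; have nk := ltn_ord n; apply/eqP.
  rewrite !iter_Delta1_floors; try lia.
  apply: (@iter_fdiff_eq0 int _ _ k.-1); last lia.
  move=> m mk; rewrite -[LHS]/(iter d.+1 Delta1 fl m); set z := iter _ _ _ _.
  have Ez : z%:~R = iter d.+1 (@fdiff R) F m - iter d.+1 (@fdiff R) fr m.
    by rewrite iter_fdiffB opprB addrCA subrr addr0 iter_fdiff_intr.
  have /andP[H1 H2] := @iter_fdiff_prog_bound c m ltac:(lia) gc.
  have gN : 0 < g N%:R.
    apply: (tame_top_gt0 fa); apply: le_trans ab _.
    by rewrite ler_nat (leq_trans _ pN) // leq_addr.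
  have H0 : 0 <= g N%:R * r%:R ^+ d.+1 by rewrite mulr_ge0 ?(ltW gN) ?exprn_ge0.
  have H3 : `|iter d.+1 (@fdiff R) fr m| <= 2^-1.
    rewrite iterSr (_ : 2^-1 = 2 ^+ d * (2 ^+ d.+1)^-1); last first.
      by rewrite exprS; field; rewrite expf_neq0.
    by apply: iter_fdiff_bound => i id; apply: close; lia.
  move: H3; rewrite ler_norml => /andP[H3 H4].
  have z1 : z < 1 by rewrite -(ltr_int R) Ez; lra.
  have z2 : -1 < z by rewrite -(ltr_int R) Ez; lra.
  lia.
Qed.

End Tame.

(** * Counting *)

Section Counting.
Variables (R : realType) (f : R -> R) (n0 d k : nat) (a : R).
Hypothesis fa : tame f d a.
Hypothesis dk : (d + 2 <= k)%N.
Local Notation g := (derive1n d.+1 f).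
(* X is determined by X^(d+1) = 1 / g(N). *)
Variables (N : nat) (X : R).
Hypotheses (X0 : 0 < X) (XE : X ^+ d.+1 * g N%:R = 1).

Lemma good_pair_step (p : 'I_N.+1 * 'I_N.+1) :
  p \in good_pairs f n0 k d N -> a <= p.1%:R -> p.2%:R <= 2 * X.
Proof.
rewrite inE => /and4P[_ p0 pN calP] ap.
have := good_small_step fa dk ap p0 pN calP => H.
have Xd : 0 < X ^+ d.+1 by rewrite exprn_gt0.
rewrite -(@ler_pXn2r _ d.+1) ?nnegrE ?mulr_ge0 ?(ltW X0) //.
by have := ler_wpM2l (ltW Xd) H; rewrite exprMn mulrA XE mul1r [leRHS]mulrC.
Qed.

Lemma card_ord_lt n m : (#|[set i : 'I_n | (i < m)%N]%SET| <= m)%N.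
Proof.
have [nm|/ltnW mn] := leqP n m.
  by rewrite (leq_trans (max_card _)) // card_ord.
have inj : injective (widen_ord mn) by move=> i j /(congr1 val) /= /val_inj.
apply: (@leq_trans #|[set widen_ord mn j | j : 'I_m]%SET|); last first.
  by rewrite card_imset // card_ord.
apply/subset_leq_card/fintype.subsetP => i; rewrite inE => im.
by apply/imsetP; exists (Ordinal im) => //; exact: val_inj.
Qed.

(** Either b < A, or r <= 2 X; as r takes at most N + 1 values, the first case is
    absorbed by the main term once A < X. *)
Lemma card_good_pairs_upper (A : nat) : a <= A%:R -> A.+1%:R <= X -> (0 < N)%N ->
  #|good_pairs f n0 k d N|%:R <= 6 * (N%:R * X).
Proof.
move=> aA AX N0; pose L := Num.truncn (2 * X).
have sub : good_pairs f n0 k d N \subset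
    (finset.setX [set i : 'I_N.+1 | (i < A)%N] [set: 'I_N.+1] :|:
     finset.setX [set: 'I_N.+1] [set i : 'I_N.+1 | (i < L.+1)%N])%SET.
  apply/fintype.subsetP => p pG; rewrite !inE !andbT /= ltnS.
  case: ltnP => //= Ap; rewrite truncn_ge_nat ?mulr_ge0 ?(ltW X0) //.
  by apply: (good_pair_step pG); rewrite (le_trans aA) // ler_nat.
have := leq_trans (subset_leq_card sub) (leq_card_setU _ _).
rewrite !cardsX cardsT card_ord => H.
have cA := card_ord_lt N.+1 A; have cL := card_ord_lt N.+1 L.+1.
have H2 : (#|good_pairs f n0 k d N| <= N.+1 * (A + L.+1))%N by nia.
have L2 : L%:R <= 2 * X by rewrite -truncn_ge_nat ?mulr_ge0 ?(ltW X0).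
apply: (@le_trans _ _ (2 * N%:R * (3 * X))); last by lra.
rewrite (le_trans (_ : _ <= (N.+1 * (A + L.+1))%:R)) ?ler_nat //.
rewrite natrM ler_pM //.
  by rewrite -natrM ler_nat; lia.
by rewrite natrD; move: AX; rewrite -!natr1; lra.
Qed.

(* M + 1 colours, so that the range of [inord] is visibly a successor. *)
Let M := (2 ^ d.+1)%N.

Let color (n : nat) : 'I_M.+1 :=
  inord (Num.truncn (M%:R * (f n%:R - (Num.floor (f n%:R))%:~R))).

Lemma close_of_color m n : color m = color n ->
  `|(f m%:R - (Num.floor (f m%:R))%:~R) - (f n%:R - (Num.floor (f n%:R))%:~R)|
     <= (2 ^+ d.+1)^-1.
Proof.
have fr (x : R) : 0 <= x - (Num.floor x)%:~R < 1.
  by rewrite subr_ge0 floor_le ltrBlDl -intrD1 floorD1_gt.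
have M0 : 0 < M%:R :> R by rewrite ltr0n expn_gt0.
move=> /(congr1 val); rewrite /= !inordK; first last.
- have /andP[h0 h1] := fr (f m%:R); rewrite truncn_lt_nat ?mulr_ge0 ?(ltW M0) //.
  by rewrite (lt_trans (_ : _ < M%:R)) ?ltr_nat // gtr_pMr.
- have /andP[h0 h1] := fr (f n%:R); rewrite truncn_lt_nat ?mulr_ge0 ?(ltW M0) //.
  by rewrite (lt_trans (_ : _ < M%:R)) ?ltr_nat // gtr_pMr.
have /andP[/(mulr_ge0 (ltW M0))/truncn_itv/andP[m1 m2] _] := fr (f m%:R).
have /andP[/(mulr_ge0 (ltW M0))/truncn_itv/andP[n1 n2] _] := fr (f n%:R).
move=> E; rewrite E in m1 m2.
set u := f m%:R - _ in m1 m2 *; set v := f n%:R - _ in n1 n2 *.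
rewrite -natrX -/M -[leRHS]mul1r ler_pdivlMr // -(gtr0_norm M0) -normrM.
rewrite -natr1 in m2; rewrite -natr1 in n2.
rewrite mulrBl ler_norml; apply/andP; split; lra.
Qed.

Variable V : nat.
Hypothesis vdwV : forall c : nat -> 'I_M.+1, exists b r,
    [/\ (r <= V)%N, (b + k.-1 * r < V)%N & mono_ap c k.-1 b r].

(** A double count in the manner of Varnavides. For the block x + s [0, V[, van der
    Waerden's theorem yields indices u and t such that b = x + s u and r = s t
    form a good pair. From (b, r) and (u, t) one recovers s = r / t and
    x = b - s u, so that (x, s) |-> ((b, r), (u, t)) is injective. The steps obey
    r <= X / 7, which gives 3 g(N) r^(d+1) <= 3/7 < 1/2. *)
Lemma card_good_pairs_lower :
  (0 < V)%N -> (n0 <= N./2)%N -> a <= (N./2)%:R -> (16 <= N)%N ->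
  (forall y, N%:R <= 2 * y -> y <= N%:R -> g y <= 3 * g N%:R) ->
  X <= N%:R -> 14 * V%:R <= X ->
  (448 * V%:R ^+ 3)^-1 * (N%:R * X) <= #|good_pairs f n0 k d N|%:R.
Proof.
move=> V0 n0N aN N16 dbl XN XV.
have V0' : 0 < V%:R :> R by rewrite ltr0n.
pose S := Num.truncn (X / (7 * V%:R)); pose q := (N %/ 8)%N.
have S7 : 7 * (S%:R * V%:R) <= X.
  have : S%:R <= X / (7 * V%:R) by rewrite truncn_le divr_ge0 ?mulr_ge0 ?(ltW X0).
  by rewrite ler_pdivlMr ?mulr_gt0 //; lra.
have S14 : X <= 14 * V%:R * S%:R.
  have : X / (7 * V%:R) < S.+1%:R by exact: truncnS_gt.
  by rewrite ltr_pdivrMr ?mulr_gt0 // -natr1; lra.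
have S7N : (7 * (S * V) <= N)%N.
  by rewrite -(ler_nat R) !natrM (le_trans S7).
pose base (x : 'I_q * 'I_S) := (N./2.+1 + x.1)%N.
pose step (x : 'I_q * 'I_S) := x.2.+1.
pose G := good_pairs f n0 k d N.
have /choice[h hP] : forall x, exists y : ('I_N.+1 * 'I_N.+1) * ('I_V * 'I_V.+1),
    [/\ y.1 \in G, nat_of_ord y.1.1 = (base x + step x * y.2.1)%N,
       nat_of_ord y.1.2 = (step x * y.2.2)%N & (0 < y.2.2)%N].
  move=> x; have [u [t [tV utV [t0 mono]]]] := vdwV (fun m => color (base x + step x * m)).
  have sS : (step x <= S)%N := ltn_ord x.2.
  have x1q := ltn_ord x.1.
  have uV : (u < V)%N by apply: leq_ltn_trans utV; exact: leq_addr.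
  pose b := (base x + step x * u)%N; pose r := (step x * t)%N.
  have br j : (b + j * r = base x + step x * (u + j * t))%N.
    by rewrite /b /r; ring.
  have brN : (b + k.-1 * r <= N)%N.
    rewrite br; apply: (@leq_trans (base x + S * V)%N).
      by rewrite leq_add2l leq_mul // ltnW.
    by rewrite /base; lia.
  have r0 : (0 < r)%N by rewrite muln_gt0.
  have k2 : (2 <= k)%N := leq_trans (leq_addl d 2) dk.
  have bN : (b < N.+1)%N by rewrite ltnS (leq_trans (leq_addr _ _) brN).
  have rN : (r < N.+1)%N.
    rewrite ltnS (leq_trans _ brN) // (leq_trans _ (leq_addl _ _)) //.
    by rewrite leq_pmull // -ltnS (ltn_predK k2).
  have Nb : (N < 2 * b)%N by rewrite /b /base; lia.
  have n0b : (n0 <= b)%N by rewrite (leq_trans n0N) // /b /base; lia.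
  have ab : a <= b%:R by rewrite (le_trans aN) // ler_nat /b /base; lia.
  exists ((Ordinal bN, Ordinal rN), (Ordinal uV, Ordinal (tV : (t < V.+1)%N))).
  split=> //; rewrite inE /= n0b r0 brN /=.
  apply: (calP_of_close_fracs fa dk ab r0 brN (c := 3 * g N%:R)).
  - apply: dbl; last by rewrite ler_nat -ltnS.
    by rewrite -natrM ler_nat ltnW.
  - have r7 : 7 * r%:R <= X.
      apply: le_trans S7; rewrite ler_pM2l // -natrM ler_nat leq_mul //.
    have : (7 * r%:R) ^+ d.+1 <= X ^+ d.+1 by rewrite lerXn2r ?nnegrE ?mulr_ge0 ?(ltW X0).
    have gN : 0 < g N%:R by apply: (tame_top_gt0 fa); rewrite (le_trans ab) // ler_nat -ltnS.
    move=> /(ler_wpM2r (ltW gN)); rewrite XE exprMn exprS.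
    have : 1 <= 7 ^+ d :> R by rewrite exprn_ege1 // ler1n.
    have : 0 <= r%:R ^+ d.+1 * g N%:R by rewrite mulr_ge0 ?exprn_ge0 ?(ltW gN).
    set w := _ * g N%:R; set z := 7 ^+ d => w0 z1 zw.
    have : 7 * w <= 1.
      apply: le_trans zw; rewrite -!mulrA ler_pM2l // -/w ler_peMl //.
    rewrite -mulrA [g _ * _]mulrC -/w; lra.
  - move=> j jk; have jk1 : (j.+1 <= k.-1)%N by rewrite -ltnS (ltn_predK jk).
    apply: close_of_color; rewrite !br.
    by rewrite (mono _ jk1) (mono _ (ltnW jk1)).
have hinj : injective h.
  move=> x y E; have [_ x1 x2 x0] := hP x; have [_ y1 y2 _] := hP y.
  have Es : step x = step y.
    by apply/eqP; rewrite -(eqn_pmul2r x0) -x2 E y2.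
  have Eb : base x = base y.
    by apply/eqP; rewrite -(eqn_add2r (step x * (h x).2.1)) -x1 E y1 Es.
  case: x y Es Eb {E x1 x2 x0 y1 y2} => [x1 x2] [y1 y2] [Es] /addnI Eb.
  by congr pair; apply: val_inj.
have card : (q * S <= #|G| * (V * V.+1))%N.
  have <- : #|[set h x | x : 'I_q * 'I_S]%SET| = (q * S)%N.
    by rewrite card_imset // card_prod !card_ord.
  have <- : #|finset.setX G [set: 'I_V * 'I_V.+1]%SET| = (#|G| * (V * V.+1))%N.
    by rewrite cardsX cardsT card_prod !card_ord.
  apply/subset_leq_card/fintype.subsetP => _ /imsetP[x _ ->].
  by have [hG _ _ _] := hP x; rewrite inE hG inE.
have N16q : N%:R <= 16 * q%:R :> R by rewrite -natrM ler_nat /q; lia.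
have cardR : q%:R * S%:R <= #|G|%:R * (2 * V%:R ^+ 2) :> R.
  rewrite -natrX -!natrM ler_nat (leq_trans card) // leq_mul2l; apply/orP; right; nia.
have c0 : 0 < 448 * V%:R ^+ 3 :> R by rewrite mulr_gt0 ?exprn_gt0 ?ltr0n.
rewrite (ler_pdivrMl _ _ c0).
apply: (@le_trans _ _ (16 * q%:R * (14 * V%:R * S%:R))); first by apply: ler_pM => //; exact: ltW.
have -> : 448 * V%:R ^+ 3 * #|G|%:R = 224 * V%:R * (#|G|%:R * (2 * V%:R ^+ 2)) :> R by ring.
have -> : 16 * q%:R * (14 * V%:R * S%:R) = 224 * V%:R * (q%:R * S%:R) :> R by ring.
by rewrite ler_pM2l ?mulr_gt0.
Qed.

End Counting.

(** The theorem with constants that depend only on k and d; van der Waerden's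
    bound is the only source of this dependence. *)
Lemma counted_aps_bounds (R : realType) (k d : nat) : (1 <= d)%N -> (d + 2 <= k)%N ->
  exists C1 C2 : R, [/\ 0 < C1, 0 < C2 &
    forall (n0 : nat) (f : R -> R), (1 <= n0)%N -> admissible n0 d f ->
    \forall N \near \oo,
        C1 * main_term f d N <= #|counted_aps f n0 k d N|%:R
          <= C2 * main_term f d N].
Proof.
move=> d1 dk; have [W HW] := van_der_waerden k.-1 'I_(2 ^ d.+1).+1.
pose V := W.+1.
have [C1 C10 C1E] : exists2 C1 : R, 0 < C1 & C1 = (448 * V%:R ^+ 3)^-1.
  exists (448 * V%:R ^+ 3)^-1; last by [].
  by rewrite invr_gt0; apply: mulr_gt0; [rewrite ltr0n|apply: exprn_gt0; rewrite ltr0n].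
exists C1, 6; split=> //.
move=> n0 f n01 [_ [K KH Kf] f_lower f_upper _].
have [a fa] := tame_threshold KH Kf f_lower f_upper d1.
set A := (Num.truncn `|a|).+1.
have aA : a <= A%:R by rewrite (le_trans (ler_norm a)) // ltW // truncnS_gt.
pose B : R := A.+1%:R + 14 * V%:R.
have B0 : 0 < B by rewrite ltr_wpDr // ?mulr_ge0.
have e0 : 0 < (B ^+ d.+1)^-1 by rewrite invr_gt0 exprn_gt0.
have Hsmall := near_natr (top_small KH Kf f_lower f_upper e0).
have Hdbl := near_natr (top_doubling KH Kf f_lower f_upper).
have Hquad := near_natr (top_quadratic KH Kf f_lower f_upper 1).
near=> N.
have N0 : (2 * (A + n0) + 16 <= N)%N by near: N; exact: nbhs_infty_ge.
have gB : derive1n d.+1 f N%:R <= (B ^+ d.+1)^-1 by near: N.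
have dbl : forall y, N%:R <= 2 * y -> y <= N%:R ->
    0 < derive1n d.+1 f N%:R /\ derive1n d.+1 f y <= 3 * derive1n d.+1 f N%:R by near: N.
have quad : 1 <= N%:R ^+ 2 * derive1n d.+1 f N%:R by near: N.
have N1 : 1 <= N%:R :> R by rewrite (ler_nat _ 1); clear -N0; lia.
have g0 : 0 < derive1n d.+1 f N%:R by have [] := dbl N%:R ltac:(lra) (lexx _).
pose X := derive1n d.+1 f N%:R `^ (-1 / d.+1%:R).
have X0 : 0 < X by exact: powR_gt0.
have XE : X ^+ d.+1 * derive1n d.+1 f N%:R = 1.
  rewrite -powR_mulrn ?(ltW X0) // /X -powRrM divfK ?pnatr_eq0 //.
  by rewrite powR_inv1 ?(ltW g0) // mulVf // gt_eqF.
have XB : B <= X.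
  rewrite -(@ler_pXn2r _ d.+1) ?nnegrE ?(ltW B0) ?(ltW X0) //.
  rewrite -(ler_pM2r g0) XE mulrC -ler_pdivlMr ?exprn_gt0 //.
  by rewrite div1r.
have XN : X <= N%:R.
  rewrite -(@ler_pXn2r _ d.+1) ?nnegrE ?(ltW X0) //.
  rewrite -(ler_pM2r g0) XE (le_trans quad) // ler_pM2r //.
  by rewrite ler_weXn2l.
have BA : A.+1%:R <= B by rewrite lerDl mulr_ge0.
have BV : 14 * V%:R <= B by rewrite lerDr.
rewrite (card_counted_aps _ _ _ n01 (leq_trans (leq_addl d 2) dk)).
rewrite /main_term -/X; apply/andP; split.
  have vdwV (c : nat -> 'I_(2 ^ d.+1).+1) : exists b r,
      [/\ (r <= V)%N, (b + k.-1 * r < V)%N & mono_ap c k.-1 b r].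
    by have [b [r [rW brW mono]]] := HW c; exists b, r; split=> //; exact: ltnW.
  have n0N : (n0 <= N./2)%N by clear -N0; lia.
  have aN : a <= (N./2)%:R by rewrite (le_trans aA) // ler_nat; clear -N0; lia.
  have N16 : (16 <= N)%N by clear -N0; lia.
  rewrite C1E; apply: (card_good_pairs_lower fa dk X0 XE vdwV (ltn0Sn W) n0N aN N16 _ XN).
    by move=> y y1 y2; have [] := dbl y y1 y2.
  exact: le_trans XB.
apply: (card_good_pairs_upper n0 fa dk X0 XE aA); last by clear -N0; lia.
exact: le_trans XB.
Unshelve. all: by end_near. Qed.

Theorem theorem2p3 (R : realType) :
  (forall (n0 d : nat) (f : R -> R),
      (1 <= n0)%N -> (1 <= d)%N -> admissible n0 d f ->
    forall k : nat, (d + 2 <= k)%N ->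
    exists C1 C2 : R, [/\ 0 < C1, 0 < C2 &
      \forall N \near \oo,
        C1 * main_term f d N <= #|counted_aps f n0 k d N|%:R
          <= C2 * main_term f d N])
  /\
  (forall (k d : nat) (c : R -> R),
      (1 <= d)%N -> (d + 2 <= k)%N ->
      (forall delta : R, 0 < delta < 1 -> 1 <= c delta) ->
    exists C1 C2 : R, [/\ 0 < C1, 0 < C2 &
      forall (n0 : nat) (f : R -> R),
        (1 <= n0)%N -> admissible n0 d f -> dilation_bound n0 d f c ->
      \forall N \near \oo,
        C1 * main_term f d N <= #|counted_aps f n0 k d N|%:R
          <= C2 * main_term f d N]).
Proof.
split=> [n0 d f n01 d1 fadm k dk|k d c d1 dk _];
  have [C1 [C2 [C10 C20 H]]] := counted_aps_bounds R d1 dk; exists C1, C2; split=> //.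
  exact: H n01 fadm.
by move=> n0 f n01 fadm _; exact: H n01 fadm.
Qed.
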